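(* Consider the Diophantine equation $$F_{n_1}F_{n_2}F_{n_3}\cdots F_{n_k}-1 = F_m^2$$ in integers $m\geq 0$, $k\geq 1$, and $0\leq n_1 \leq n_2 \leq \cdots \leq n_k$. It has a solution for every $m\geq 0$. Moreover, the nontrivial solutions are exactly those given by $$F_1-1 = F_2-1 = F_0^2,\quad F_3-1 = F_1^2, \quad F_3-1 = F_2^2, \quad F_5-1 = F_3^2,$$ together with the infinite family $$F_{m-\delta}F_{m+\delta}-1 = F_m^2\quad\text{for all } m\geq 4,$$ where $\delta=\delta(m)=1$ if $m$ is even and $\delta=\delta(m)=2$ if $m$ is odd.
   Context: $(F_n)_{n\ge 0}$ is the Fibonacci sequence: $F_0=0$, $F_1=1$, $F_n=F_{n-1}+F_{n-2}$ for $n\ge 2$. A solution is a tuple $(m,k,n_1,\dots,n_k)$; the indices $n_i$ need not be distinct, and each displayed product specifies a tuple of indices. A solution is called nontrivial if either $k=1$, or $k\geq 2$ and $n_1\geq 3$. *)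

(* Defs.v *)
From mathcomp Require Import all_boot all_order all_algebra.

Set Implicit Arguments.
Unset Strict Implicit.
Unset Printing Implicit Defensive.

Import Order.TTheory GRing.Theory Num.Theory.

Fixpoint fib (n : nat) : nat :=
  match n with
  | 0 => 0
  | n1.+1 => if n1 is n2.+1 then fib n1 + fib n2 else 1
  end.

(* A solution (m, k, n_1, ..., n_k) is given by m, k and the k-tuple n, with
   n_i stored at position i - 1. The equation is stated in int: with truncated
   subtraction in nat, a zero factor would give a spurious solution with m = 0. *)
Definition is_solution (m k : nat) (n : k.-tuple nat) : Prop :=
  [/\ 1 <= k, sorted leq n
    & ((\prod_(i < k) (fib (tnth n i))%:Z) - 1 = (fib m)%:Z ^+ 2)%R].

(* nth 0 n 0 is n_1 when k >= 1. *)
Definition nontrivial (k : nat) (n : k.-tuple nat) : Prop :=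
  k = 1 \/ (2 <= k /\ 3 <= nth 0 n 0).

Definition delta (m : nat) : nat := if odd m then 2 else 1.

(* The pair (m, [:: n_1; ...; n_k]) stands for F_{n_1}...F_{n_k} - 1 = F_m^2;
   k is the length of the list. *)
Definition sporadic : seq (nat * seq nat) :=
  [:: (0, [:: 1]); (0, [:: 2]); (1, [:: 3]); (2, [:: 3]); (3, [:: 5])].

Definition in_family (m : nat) (s : seq nat) : Prop :=
  4 <= m /\ s = [:: m - delta m; m + delta m].

(* Main.v *)
Require Import Defs.
From mathcomp Require Import all_boot all_order all_algebra.
From mathcomp Require Import zify ring.

Set Implicit Arguments.
Unset Strict Implicit.
Unset Printing Implicit Defensive.

Import GRing.Theory.

(** For even [m] put [a = m - 1], [b = m + 1], for odd [m] put [a = m - 2],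
    [b = m + 2]; then [a], [b] are odd and coprime, and Cassini's identity gives
    [F_m ^ 2 + 1 = F_a * F_b]. If [n >= 3] and [F_n] divides [F_a * F_b], then
    [F_n <= F_(gcd n a) * F_(gcd n b)], which by size forces [n | a] or [n | b].
    So the factors split into a factorization of [F_a] with indices dividing [a]
    and one of [F_b] with indices dividing [b].

    It remains to see that, for [a] odd, [F_a] is not a product of [F_n] with [n]
    running over proper divisors of [a]. This does not need Carmichael's theorem
    on primitive divisors. Let [r] be the largest prime factor of [a], let [r^e]
    be its exact power in [a], and [t = a / r]. If two of the indices do not
    divide [t], both are multiples of [r^e], so [F_(r^e) ^ 2 | F_a], and hence
    [F_(r^e) | a / r^e]; but a prime factor [l <= r - 2] of [F_r] would have rank of
    apparition at most [l + 1 < r], whereas that rank is [r]. So at most one index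
    does not divide [t]. The product over the other indices divides [r * F_t] by
    lifting the exponent, whence [F_a <= F_(a/3) * r * F_t], which is too small. *)

(** * Growth and divisibility of Fibonacci numbers *)

Lemma fibSS n : fib n.+2 = fib n.+1 + fib n.
Proof. by []. Qed.

Lemma fibDS m n : fib (m + n).+1 = fib m.+1 * fib n.+1 + fib m * fib n.
Proof.
elim: m n => [|m IHm] n; first by rewrite add0n mul1n mul0n addn0.
by rewrite addSnnS IHm !fibSS; ring.
Qed.

Lemma fib_gt0 n : 0 < n -> 0 < fib n.
Proof.
case: n => // n _; elim: n => // n IHn.
by rewrite fibSS ltn_addr.
Qed.

Lemma leq_fib m n : m <= n -> fib m <= fib n.
Proof.
move=> le_mn; rewrite -(subnKC le_mn); elim: (n - m) => [|d IHd]; first by rewrite addn0.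
apply: leq_trans IHd _; rewrite addnS.
by case: (m + d) => // k; rewrite fibSS leq_addr.
Qed.

Lemma ltn_fib m n : 1 < m -> m < n -> fib m < fib n.
Proof.
case: m => [|[|m]] // _ lt_mn; apply: leq_trans (leq_fib lt_mn).
by rewrite [X in _ < X]fibSS -[X in X < _]addn0 ltn_add2l fib_gt0.
Qed.

Lemma fib_gt1 n : 2 < n -> 1 < fib n.
Proof. exact: (@ltn_fib 2). Qed.

Lemma fib_mul_leq m n : 0 < m -> 0 < n -> fib m * fib n <= fib (m + n).-1.
Proof.
by case: m n => [|m] [|n] // _ _; rewrite addSn addnS -pred_Sn fibDS leq_addr.
Qed.

Lemma coprime_fibS n : coprime (fib n) (fib n.+1).
Proof.
elim: n => // n IHn; rewrite fibSS /coprime gcdnDl gcdnC; exact: IHn.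
Qed.

(** Euclid's algorithm by subtraction: modulo [fib m], the addition formula turns [fib n] into
    [fib m.-1 * fib (n - m)], whose first factor is coprime to [fib m]. *)
Lemma gcdn_fib m n : gcdn (fib m) (fib n) = fib (gcdn m n).
Proof.
have [k] := ubnP (m + n); elim: k m n => // k IHk m n.
wlog le_mn: m n / m <= n => [hw|] le_k.
  case: (leqP m n) => [|/ltnW] le; first exact: hw.
  by rewrite gcdnC [gcdn m n]gcdnC hw // addnC.
case: m => [|m] in le_mn le_k *; first by rewrite !gcd0n.
rewrite -{2}(subnKC le_mn) gcdnDl -IHk; last by lia.
rewrite -{1}(subnKC le_mn) addSn fibDS [fib m.+1 * _]mulnC gcdnMDl Gauss_gcdr //.
rewrite coprime_sym; exact: coprime_fibS.
Qed.

Lemma dvdn_fib m n : m %| n -> fib m %| fib n.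
Proof. by move=> /gcdn_idPl <-; rewrite -gcdn_fib dvdn_gcdr. Qed.

(** * Lifting the exponent *)

(** The second-order term is kept because [dvdn_fib_mul_prime] needs the bracket modulo [r ^ 2] when
    [r] divides [fib n.+1]. *)
Lemma fib_mul_expansion n s : exists c,
  fib (n.+1 * s.+1) = fib n.+1 * (s.+1 * fib n ^ s
    + 'C(s.+1, 2) * fib n.+1 * fib n ^ s.-1 + c * fib n.+1 ^ 2).
Proof.
set u := fib n.+1; set v := fib n.
(* Expands the power [M^(n+1) = u M + v] of the Fibonacci matrix [M]. *)
suff [c [d [Fc _]]] : exists c d,
    fib (n + n.+1 * s).+1 = u * (s.+1 * v ^ s + 'C(s.+1, 2) * u * v ^ s.-1 + c * u ^ 2)
    /\ fib (n + n.+1 * s) = v ^ s.+1 + d * u ^ 2.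
  by exists c; rewrite -Fc mulnS addSn.
elim: s => [|s [c [d [IHx IHz]]]].
  by exists 0, 0; rewrite muln0 addn0 -/u -/v bin_small //; split; ring.
have E : n.+1 * s.+1 = (n + n.+1 * s).+1 by rewrite mulnS addSn.
(* At [s = 0] the truncated [s.-1] is harmless, as the binomial coefficient vanishes. *)
have Cs : v * ('C(s.+1, 2) * v ^ s.-1) = 'C(s.+1, 2) * v ^ s.
  by case: (s) => [|s'] /=;
    [rewrite bin_small ?mul0n ?muln0 | rewrite [v ^ s'.+1]expnS mulnCA].
rewrite E.
set x := fib (n + n.+1 * s).+1 in IHx *; set z := fib (n + n.+1 * s) in IHz *.
have -> : fib (n + (n + n.+1 * s).+1).+1 = u * (x + z) + v * x by rewrite fibDS fibSS.
have -> : fib (n + (n + n.+1 * s).+1) = u * x + v * z by rewrite addnS fibDS.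
exists (c * u + 'C(s.+1, 2) * v ^ s.-1 + d + v * c).
exists (s.+1 * v ^ s + 'C(s.+1, 2) * u * v ^ s.-1 + c * u ^ 2 + v * d).
split; last by rewrite IHx IHz !expnS; ring.
rewrite -[s.+1.-1]/s (binS s.+1 1) bin1 [(_ + s.+1) * _]mulnDl [(_ + s.+1 * u) * _]mulnDl.
rewrite ['C(s.+1, 2) * u * v ^ s]mulnAC -Cs IHx IHz !expnS; ring.
Qed.

(** After one [fib n] is cancelled, the expansion is, modulo [fib n], just [t] times a power of the
    coprime number [fib n.-1]. *)
Lemma sqr_fib_dvd n t : 0 < n -> 0 < t -> fib n ^ 2 %| fib (n * t) -> fib n %| t.
Proof.
case: n t => [|n] [|s] // _ _; have [c ->] := fib_mul_expansion n s.
rewrite expnS expn1 dvdn_pmul2l ?fib_gt0 // -addnA dvdn_addl.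
  rewrite Gauss_dvdl // coprimeXr // coprime_sym; exact: coprime_fibS.
by apply: dvdn_add; [rewrite mulnAC dvdn_mull | rewrite dvdn_mull ?dvdn_mulr].
Qed.

(** Valuations are compared prime by prime: among the primes dividing [fib n], only [r] can divide
    the cofactor [Q] of [fib n] in [fib (n * r)], and only once. *)
Lemma dvdn_fib_mul_prime n r X : 0 < n -> 0 < X -> prime r -> odd r ->
    X %| fib (n * r) -> (forall p, prime p -> p %| X -> p %| fib n) ->
  X %| r * fib n.
Proof.
case: n => [|n] // _ X0 r_pr r_odd.
have [s def_r] : exists s, r = s.+1 by exists r.-1; rewrite prednK // prime_gt0.
have [c] := fib_mul_expansion n s; rewrite -def_r.
set u := fib n.+1; set v := fib n; set Q := _ + _ => Fr.
have Q_gt0 : 0 < Q.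
  suff: 0 < u * Q by rewrite muln_gt0 => /andP[].
  by rewrite -Fr; apply: fib_gt0; rewrite muln_gt0 (prime_gt0 r_pr).
rewrite Fr => dvdX radX; have u0 : 0 < u by rewrite fib_gt0.
have co_uv: coprime u v by rewrite coprime_sym; exact: coprime_fibS.
have nQ p : prime p -> p %| u -> ~~ (p %| v ^ s).
  move=> p_pr pu; rewrite -prime_coprime // coprimeXr //.
  exact: coprime_dvdl pu co_uv.
apply/dvdn_partP=> // p; rewrite mem_primes => /and3P[p_pr _ pX].
have pu := radX p p_pr pX.
rewrite p_part pfactor_dvdn ?muln_gt0 ?(prime_gt0 r_pr) //.
apply: leq_trans (dvdn_leq_log p _ dvdX) _; first by rewrite muln_gt0 u0.
rewrite !lognM ?(prime_gt0 r_pr) // addnC leq_add2r.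
have [p_r | ne_pr] := eqVneq p r.
  rewrite p_r (logn_prime r r_pr) eqxx leqNgt -pfactor_dvdn //.
  rewrite p_r in pu.
  (* As [r] is odd, it divides both ['C(r, 2)] and [u], so all terms of [Q] but the first vanish
     modulo [r ^ 2]. *)
  rewrite /Q -addnA dvdn_addl.
    rewrite expnS expn1 dvdn_pmul2l ?prime_gt0 //; exact: nQ.
  apply: dvdn_add; last by rewrite dvdn_mull ?dvdn_exp2r.
  by rewrite dvdn_mulr // expnS expn1 dvdn_mul ?prime_dvd_bin ?odd_prime_gt2.
rewrite lognE p_pr Q_gt0 /=; case: ifP => // pQ; exfalso.
move: pQ; rewrite /Q -addnA dvdn_addl.
  rewrite Euclid_dvdM // (negPf (nQ _ _ _)) // orbF dvdn_prime2 //.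
  by rewrite (negPf ne_pr).
by apply: dvdn_add; [rewrite mulnAC dvdn_mull | rewrite dvdn_mull ?dvdn_exp].
Qed.

(** * Rank of apparition and divisors of Fibonacci numbers *)

Lemma fib_dOcagne (R : comNzRingType) i d :
  ((fib i.+1)%:R * (fib (i + d))%:R - (fib i)%:R * (fib (i + d).+1)%:R
   = (-1) ^+ i * (fib d)%:R :> R)%R.
Proof.
elim: i => [|i IHi]; first by rewrite add0n mul0r subr0.
rewrite addSn !fibSS exprS -mulrA -IHi !natrD; ring.
Qed.

(* Otherwise the [l] ratios [F_(i+2) / F_(i+1)], [i < l], would be distinct and
   nonzero in ['F_l]: equal ratios give a zero by d'Ocagne's identity. *)
Lemma fib_rank l : prime l -> exists j, [/\ 0 < j, j <= l.+1 & l %| fib j].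
Proof.
move=> l_pr.
case: (boolP [exists i : 'I_l.+1, l %| fib i.+1]) => [/existsP[i li]|].
  by exists i.+1.
rewrite negb_exists => /forallP nl.
have nz k : k <= l -> ((fib k.+1)%:R != 0 :> 'F_l)%R.
  move=> le_kl; rewrite -(dvdn_pcharf (pchar_Fp l_pr)).
  exact: nl (Ordinal (le_kl : k < l.+1)).
pose f (i : 'I_l) : 'F_l := ((fib i.+2)%:R / (fib i.+1)%:R)%R.
suff /inj_card_onto onto_f : injective f.
  have /codomP[i /esym/eqP] : 0%R \in codom f by rewrite onto_f // card_Fp // card_ord.
  by rewrite mulf_eq0 invr_eq0 !(negPf (nz _ _)) // ltnW.
move=> i j; wlog le_ij: i j / i <= j => [hw eq_f|].
  by case: (leqP i j) => [|/ltnW] le; [|apply/esym]; apply: hw.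
move=> /eqP; rewrite /f eqr_div ?nz ?(ltnW (ltn_ord _)) // => /eqP eq_f.
apply/val_inj/eqP; rewrite eqn_leq le_ij leqNgt; apply/negP => lt_ij.
have := fib_dOcagne 'F_l i.+1 (j - i).
rewrite addSn subnKC // eq_f [X in (X - _)%R]mulrC subrr.
move/esym/eqP; rewrite mulf_eq0 signr_eq0 /=.
rewrite -(prednK (_ : 0 < j - i)) ?subn_gt0 // (negPf (nz _ _)) //.
by apply: leq_trans (leq_pred _) _; apply: leq_trans (leq_subr _ _) (ltnW (ltn_ord j)).
Qed.

(** Otherwise both gcds are proper divisors of [n], hence at most [n / 2], and the product of their
    Fibonacci numbers is at most [fib n.-1 < fib n]. *)
Lemma dvdn_fib_mul n a b :
  2 < n -> fib n %| fib a * fib b -> (n %| a) || (n %| b).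
Proof.
move=> n_gt2 dvd_n; have n_gt0 : 0 < n by exact: ltn_trans n_gt2.
have le_n : fib n <= fib (gcdn n a) * fib (gcdn n b).
  apply: dvdn_leq; first by rewrite muln_gt0 !fib_gt0 // gcdn_gt0 n_gt0.
  by rewrite -!gcdn_fib muln_gcdl dvdn_gcd dvdn_mulr //= muln_gcdr dvdn_gcd dvdn_mull.
have half c : ~~ (n %| c) -> (gcdn n c).*2 <= n.
  move=> nc; have /dvdnP[q def_n] := dvdn_gcdl n c.
  rewrite [X in _ <= X]def_n -mul2n leq_mul2r; apply/orP; right.
  case: q def_n => [|[|q]] //; first by move=> n0; rewrite n0 in n_gt0.
  by rewrite mul1n => /esym/gcdn_idPl; rewrite (negPf nc).
rewrite -[_ || _]negbK negb_or; apply/negP => /andP[/half ha /half hb].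
have : fib (gcdn n a + gcdn n b).-1 <= fib n.-1 by apply: leq_fib; lia.
have : fib n.-1 < fib n by apply: ltn_fib; lia.
have : fib (gcdn n a) * fib (gcdn n b) <= fib (gcdn n a + gcdn n b).-1.
  by apply: fib_mul_leq; rewrite gcdn_gt0 n_gt0.
lia.
Qed.

(** If [l < r], the rank [j] satisfies [j <= l + 1 < r], strictly by parity, so [l] divides
    [fib (gcdn r j) = fib 1]. *)
Lemma leq_prime_dvd_fib r l : prime r -> odd r -> prime l -> odd l -> l %| fib r -> r <= l.
Proof.
move=> r_pr r_odd l_pr l_odd l_r; rewrite leqNgt; apply/negP => lt_lr.
have [j [j_gt0 le_jl l_j]] := fib_rank l_pr.
have lt_jr : j < r.
  apply: leq_ltn_trans le_jl _; rewrite ltn_neqAle lt_lr andbT.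
  by apply/eqP => eq_r; rewrite -eq_r /= l_odd in r_odd.
have : l %| gcdn (fib r) (fib j) by rewrite dvdn_gcd l_r.
have /eqP co_rj : coprime r j by rewrite prime_coprime // gtnNdvd.
by rewrite gcdn_fib co_rj dvdn1 => /eqP l1; rewrite l1 in l_pr.
Qed.

(** * Products over divisors of an odd index *)

(** If [n] had fewer factors [r] than [m], one of them could be removed from [m] and [n] would still
    divide it. *)
Lemma pfactor_dvd_of_ndvd_div r n m : prime r -> 0 < m -> r %| m ->
  n %| m -> ~~ (n %| m %/ r) -> r ^ logn r m %| n.
Proof.
move=> r_pr m_gt0 rm nm; apply: contraR => nrn.
have n_gt0 := dvdn_gt0 m_gt0 nm.
rewrite pfactor_dvdn // -ltnNge in nrn.
have [m' co_rm' def_m] := pfactor_coprime r_pr m_gt0.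
have [n' co_rn' def_n] := pfactor_coprime r_pr n_gt0.
have n'm' : n' %| m'.
  rewrite -(Gauss_dvdl m' (_ : coprime n' (r ^ logn r m))) -?def_m.
    by apply: dvdn_trans nm; rewrite def_n dvdn_mulr.
  by rewrite coprimeXr // coprime_sym.
rewrite -(dvdn_pmul2r (prime_gt0 r_pr)) divnK // def_n def_m -mulnA -expnSr.
by rewrite dvdn_mul // dvdn_exp2l.
Qed.

Lemma mem_fib_prod a (s : seq nat) : odd a -> 2 < a ->
    {in s, forall n, 2 < n /\ n %| a} -> \prod_(n <- s) fib n = fib a -> a \in s.
Proof.
move=> a_odd a_gt2 hs prod_s; apply: contraT => a_s.
have a_gt0 : 0 < a by lia.
have r_pr : prime (max_pdiv a) by apply: max_pdiv_prime; lia.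
have r_a := max_pdiv_dvd a.
have r_max l : prime l -> l %| a -> l <= max_pdiv a.
  by move=> l_pr l_a; apply: max_pdiv_max; rewrite mem_primes l_pr a_gt0.
move: (max_pdiv a) => r in r_pr r_a r_max.
have r_odd : odd r := dvdn_odd r_a a_odd.
have r_gt2 : 2 < r by exact: odd_prime_gt2.
set t := a %/ r.
have def_a : a = t * r by rewrite divnK.
have t_gt0 : 0 < t by case: (t) def_a => // def_a; rewrite def_a in a_gt0.
have t_odd : odd t by apply: dvdn_odd a_odd; rewrite def_a dvdn_mulr.
(* If [t = 1], then [a] is prime, and any index, being a divisor above 2, is [a] itself. *)
have t_gt2 : 2 < t.
  rewrite ltn_neqAle leqNgt; apply/andP; split.
    by apply/eqP => t2; rewrite -t2 in t_odd.
  apply/negP => t_lt2.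
  have a_r : a = r by rewrite def_a (_ : t = 1) ?mul1n //; lia.
  case: s hs prod_s a_s => [|n s] hs prod_s.
    by move: (fib_gt1 a_gt2); rewrite -prod_s big_nil.
  have [n_gt2 n_a] := hs n (mem_head _ _); rewrite in_cons negb_or => /andP[/negP[]].
  move: n_a; rewrite a_r => /(primeP r_pr).2 /orP[/eqP n1|/eqP->//].
  by rewrite n1 in n_gt2.
set S := [seq n <- s | ~~ (n %| t)].
set P2 := \prod_(n <- s | n %| t) fib n.
have prodS : (\prod_(n <- S) fib n) * P2 = fib a.
  by rewrite -prod_s big_filter mulnC [RHS](bigID (fun n => n %| t)).
have P2_dvd : P2 %| r * fib t.
  apply: dvdn_fib_mul_prime => //.
  - by rewrite prodn_cond_gt0 // => n /(dvdn_gt0 t_gt0)/fib_gt0.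
  - by rewrite -def_a -prodS dvdn_mull.
  move=> p p_pr; rewrite /P2; elim/big_rec: _ => [|n x n_t IHx].
    by rewrite dvdn1 => /eqP p1; rewrite p1 in p_pr.
  rewrite Euclid_dvdM // => /orP[p_n|/IHx//]; exact: dvdn_trans p_n (dvdn_fib n_t).
have P2_le : P2 <= r * fib t.
  by apply: dvdn_leq P2_dvd; rewrite muln_gt0 fib_gt0 // prime_gt0.
have S_sub : {in S, forall n, [/\ 2 < n, n %| a, n != a & ~~ (n %| t)]}.
  move=> n; rewrite mem_filter => /andP[n_t n_s]; have [n_gt2 n_a] := hs n n_s.
  by split=> //; apply: contraNneq a_s => <-.
(* A single index is a proper divisor of the odd [a], hence at most [a / 3]; two indices are
   contradictory. *)
have S_le : \prod_(n <- S) fib n <= fib (a %/ 3).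
  case defS: S S_sub prodS => [|n1 [|n2 S']] S_sub prodS.
  - by rewrite big_nil fib_gt0 // divn_gt0.
  - rewrite big_seq1; apply: leq_fib; rewrite leq_divRL //.
    have [n_gt2 /dvdnP[q def_q] n_a _] := S_sub n1 (mem_head _ _).
    rewrite def_q mulnC leq_mul2r; apply/orP; right.
    case: q def_q => [|[|[|q]]] // def_q; first by rewrite def_q in a_gt0.
      by rewrite def_q mul1n eqxx in n_a.
    by rewrite def_q mul2n odd_double in a_odd.
  have [_ n1_a _ n1_t] := S_sub n1 (mem_head _ _).
  have [|_ n2_a _ n2_t] := S_sub n2; first by rewrite !inE eqxx orbT.
  have [a' co_ra' def_a'] := pfactor_coprime r_pr a_gt0.
  have R1 := pfactor_dvd_of_ndvd_div r_pr a_gt0 r_a n1_a n1_t.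
  have R2 := pfactor_dvd_of_ndvd_div r_pr a_gt0 r_a n2_a n2_t.
  have : fib (r ^ logn r a) %| a'.
    apply: sqr_fib_dvd.
    - by rewrite expn_gt0 prime_gt0.
    - by case: (a') def_a' => // a0; rewrite a0 in a_gt0.
    rewrite mulnC -def_a' -prodS !big_cons mulnA expnS expn1; do 2 apply: dvdn_mulr.
    by rewrite dvdn_mul ?dvdn_fib.
  have r_pow : r %| r ^ logn r a by rewrite dvdn_exp // logn_gt0 mem_primes r_pr a_gt0.
  move/(dvdn_trans (dvdn_fib r_pow))=> r_a'.
  (* The least prime factor of [fib r] divides [a], so it is odd and at most [r]; it is also at
     least [r], yet [r] does not divide [a']. *)
  have l_pr : prime (pdiv (fib r)) by apply/pdiv_prime/fib_gt1.
  have l_a' := dvdn_trans (pdiv_dvd (fib r)) r_a'.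
  have l_a : pdiv (fib r) %| a by rewrite def_a' dvdn_mulr.
  have le_lr := r_max _ l_pr l_a.
  have le_rl := leq_prime_dvd_fib r_pr r_odd l_pr (dvdn_odd l_a a_odd) (pdiv_dvd _).
  have eq_lr : pdiv (fib r) = r by apply/eqP; rewrite eqn_leq le_lr.
  by rewrite eq_lr in l_a'; move: co_ra'; rewrite prime_coprime // l_a'.
(* This absorbs the factor [r] into the index, giving [P2 <= fib (r + t)]. *)
have r_le : r <= fib r.+1.
  move: r_gt2; clear; elim: r => // r IHr; rewrite ltnS leq_eqVlt => /orP[/eqP<-//|gt2].
  by apply: leq_ltn_trans (IHr gt2) (ltn_fib _ _) => //; lia.
have := fib_mul_leq (ltn0Sn r) t_gt0.
have a3_gt0 : 0 < a %/ 3 by rewrite divn_gt0.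
have := fib_mul_leq (_ : 0 < (r.+1 + t).-1) a3_gt0.
move=> h1 h2.
have : fib a <= fib ((r.+1 + t).-1 + a %/ 3).-1.
  rewrite -prodS mulnC; apply: leq_trans (h1 _); last by lia.
  apply: leq_mul => //; apply: leq_trans h2; apply: leq_trans P2_le _; exact: leq_mul.
rewrite leqNgt ltn_fib //; first lia.
(* Equality holds at [r = t = 3]; the index saved by [fib_mul_leq] keeps the final bound strict. *)
have rt_le : 3 * (r + t) <= 2 * a.
  have [r' def_r] : exists r', r = r' + 3 by exists (r - 3); lia.
  have [t' def_t] : exists t', t = t' + 3 by exists (t - 3); lia.
  rewrite def_a def_r def_t; clear; lia.
have := leq_divM a 3; move: rt_le a_gt2; clear; lia.
Qed.

(** * Solving the equation *)

Lemma fib_family m : 1 < m ->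
  fib (m - delta m) * fib (m + delta m) = fib m ^ 2 + 1.
Proof.
(* For odd [m] the claim also follows from this instance: both sides unfold to quadratic forms in
   [fib k.*2.+1] and [fib k.*2.+2]. *)
have cassini k : fib k.*2.+1 * fib k.*2.+3 = fib k.*2.+2 ^ 2 + 1.
  by elim: k => // k IHk; rewrite doubleS !fibSS in IHk *; lia.
move=> m_gt1; rewrite /delta; case: ifP => m_odd.
  have [k ->] : exists k, m = k.*2.+3 by exists (m - 3)./2; lia.
  by rewrite !subSS subn0 addn2; have := cassini k; rewrite !fibSS; lia.
have [k ->] : exists k, m = k.*2.+2 by exists (m - 2)./2; lia.
by rewrite subSS subn0 addn1.
Qed.

Lemma fib_prod_coprime (s : seq nat) (P : pred nat) b :
    {in s, forall n, P n -> coprime n b} ->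
  coprime (\prod_(n <- s | P n) fib n) (fib b).
Proof.
move=> co_sb; rewrite big_seq_cond; elim/big_rec: _ => [|n x /andP[n_s Pn] co_x].
  exact: coprime1n.
by rewrite coprimeMl co_x andbT /coprime gcdn_fib (eqP (co_sb n n_s Pn)).
Qed.

Lemma fib_prod_nil (s : seq nat) :
  {in s, forall n, 2 < n} -> \prod_(n <- s) fib n = 1 -> s = [::].
Proof.
case: s => // n s hs; rewrite big_cons => /eqP; rewrite muln_eq1 => /andP[/eqP n1 _].
by have := fib_gt1 (hs n (mem_head _ _)); rewrite n1.
Qed.

Lemma fib_prod_coprime_odd a b (s : seq nat) :
    odd a -> odd b -> 2 < a < b -> coprime a b -> sorted leq s ->
    {in s, forall n, 2 < n} -> \prod_(n <- s) fib n = fib a * fib b ->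
  s = [:: a; b].
Proof.
move=> a_odd b_odd /andP[a_gt2 lt_ab] co_ab s_sorted s_gt2 prod_s.
have b_gt2 := ltn_trans a_gt2 lt_ab.
have dvd_ab n : n \in s -> (n %| a) || (n %| b).
  move=> n_s; apply: dvdn_fib_mul; first exact: s_gt2.
  by rewrite -prod_s (big_rem n) //= dvdn_mulr.
have dvd_b n : n \in s -> ~~ (n %| a) -> n %| b by move/dvd_ab/orP=> [->|].
set P1 := \prod_(n <- s | n %| a) fib n.
set P2 := \prod_(n <- s | ~~ (n %| a)) fib n.
have P12 : P1 * P2 = fib a * fib b by rewrite -prod_s [RHS](bigID (fun n => n %| a)).
have P1_dvd : P1 %| fib a.
  rewrite -(@Gauss_dvdl _ _ (fib b)) -?P12 ?dvdn_mulr //.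
  by apply: fib_prod_coprime => n _ n_a; exact: coprime_dvdl n_a co_ab.
have P2_dvd : P2 %| fib b.
  rewrite -(@Gauss_dvdr _ (fib a)) -?P12 ?dvdn_mull //.
  apply: fib_prod_coprime => n n_s /(dvd_b n n_s) n_b.
  by apply: coprime_dvdl n_b _; rewrite coprime_sym.
have Fa_gt0 : 0 < fib a by apply: fib_gt0; lia.
have Fb_gt0 : 0 < fib b by apply: fib_gt0; lia.
have P1_le := dvdn_leq Fa_gt0 P1_dvd.
have P2_le := dvdn_leq Fb_gt0 P2_dvd.
(* Neither bound can be strict, since the products of the two sides agree. *)
have P1_eq : P1 = fib a by nia.
have P2_eq : P2 = fib b by nia.
have a_s : a \in s.
  suff : a \in [seq n <- s | n %| a] by rewrite mem_filter => /andP[].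
  apply: mem_fib_prod => //; last by rewrite big_filter.
  by move=> n; rewrite mem_filter => /andP[n_a /s_gt2].
have b_s : b \in rem a s.
  suff : b \in [seq n <- s | ~~ (n %| a)].
    by rewrite mem_filter => /andP[_]; rewrite (perm_mem (perm_to_rem a_s)) in_cons gtn_eqF.
  apply: mem_fib_prod => //; last by rewrite big_filter.
  by move=> n; rewrite mem_filter => /andP[n_a n_s]; split; [exact: s_gt2 | exact: dvd_b].
have rest_nil : rem b (rem a s) = [::].
  apply: fib_prod_nil => [n /mem_rem/mem_rem/s_gt2 // |].
  have := prod_s; rewrite (big_rem a) //= (big_rem b) //=; nia.
have s_perm : perm_eq s [:: a; b].
  by rewrite (permPl (perm_to_rem a_s)) perm_cons (permPl (perm_to_rem b_s)) rest_nil.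
apply: (sorted_eq leq_trans anti_leq) => //=.
by rewrite ltnW.
Qed.

(** From [m = 4] on, the smaller index is at least 3. The two indices are odd and differ by 2 or 4,
    hence coprime. *)
Lemma fib_prod_family m (s : seq nat) : 3 < m -> sorted leq s ->
    {in s, forall n, 2 < n} -> \prod_(n <- s) fib n = fib m ^ 2 + 1 ->
  s = [:: m - delta m; m + delta m].
Proof.
move=> m_gt3 s_sorted s_gt2; rewrite -fib_family; last by lia.
have [m_odd|m_even] := boolP (odd m); rewrite /delta ?m_odd ?(negPf m_even).
  apply: fib_prod_coprime_odd => //; try lia.
  have -> : m + 2 = m - 2 + 2 ^ 2 by lia.
  by rewrite /coprime gcdnDl; apply: coprimeXr; rewrite coprimen2; lia.
apply: fib_prod_coprime_odd => //; try lia.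
have -> : m + 1 = m - 1 + 2 by lia.
by rewrite /coprime gcdnDl; rewrite [_ == 1]coprimen2; lia.
Qed.

Lemma fib_inj_gt2 n v : 2 < v -> fib n = fib v -> n = v.
Proof.
move=> v_gt2 eq_nv; case: (ltngtP n v) => // [lt_nv|lt_vn].
  suff : fib n < fib v by rewrite eq_nv ltnn.
  have [n_gt1|n_le1] := ltnP 1 n; first exact: ltn_fib.
  by apply: leq_ltn_trans (leq_fib n_le1) (fib_gt1 v_gt2).
by have := ltn_fib (ltnW v_gt2) lt_vn; rewrite eq_nv ltnn.
Qed.

Lemma is_solutionE m k (n : k.-tuple nat) : is_solution m n <->
  [/\ 1 <= k, sorted leq n & \prod_(i <- n) fib i = fib m ^ 2 + 1].
Proof.
rewrite /is_solution big_tuple -(big_morph Posz PoszM (erefl _)).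
split=> -[k_gt0 n_sorted eq_n]; split=> //.
  by apply/eqP; rewrite -eqz_nat PoszD -subr_eq eq_n; apply/eqP; lia.
by rewrite eq_n; lia.
Qed.

(** The right side is 1, 2 or 5, none of which is a product of two factors above 1, so there is only
    one index. *)
Lemma fib_prod_small m (s : seq nat) : m < 4 -> 0 < size s ->
    size s = 1 \/ {in s, forall n, 2 < n} ->
    \prod_(n <- s) fib n = fib m ^ 2 + 1 -> (m, s) \in sporadic.
Proof.
move=> m_lt4 s_gt0 s_nt prod_s.
have [n def_s] : exists n, s = [:: n].
  case: s s_gt0 s_nt prod_s => [|n [|p s]] // _; first by exists n.
  case=> // s_gt2; rewrite !big_cons.
  have Fn := fib_gt1 (s_gt2 n (mem_head _ _)).
  have /s_gt2/fib_gt1 Fp : p \in [:: n, p & s] by rewrite !inE eqxx orbT.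
  set x := fib n in Fn *; set y := fib p in Fp *; set z := \prod_(j <- s) _.
  have : y * z <> 1 by move/eqP; rewrite muln_eq1 => /andP[/eqP y1 _]; rewrite y1 in Fp.
  move: (y * z) (x) Fn => [|[|w]] [|[|u]] // _ _ eq_uw; exfalso.
    by rewrite muln0 addn1 in eq_uw.
  have : 4 <= u.+2 * w.+2 by rewrite (@leq_mul 2 2).
  have : u.+2 * w.+2 <> 5 by case: u {eq_uw} => [|u]; lia.
  by case: m m_lt4 eq_uw => [|[|[|[|m]]]] //= _ ->.
rewrite def_s big_seq1 in prod_s * => {s s_gt0 s_nt def_s}.
case: m m_lt4 prod_s => [|[|[|[|m]]]] //= _ eq_n.
- case: n eq_n => [|[|[|n]]] // eq_n.
  by have := @fib_gt1 n.+3 isT; rewrite eq_n.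
- by rewrite (@fib_inj_gt2 n 3).
- by rewrite (@fib_inj_gt2 n 3).
by rewrite (@fib_inj_gt2 n 5).
Qed.

Theorem theorem10 :
  (forall m : nat, exists (k : nat) (n : k.-tuple nat), is_solution m n) /\
  (forall (m k : nat) (n : k.-tuple nat),
     (is_solution m n /\ nontrivial n) <->
     ((m, tval n) \in sporadic \/ in_family m (tval n))).
Proof.
split=> [m | m k n].
  (* The family identity already holds for [m = 2] and [m = 3], giving trivial solutions there. *)
  have [m_gt1|m_le1] := ltnP 1 m.
    exists 2, [tuple m - delta m; m + delta m]; apply/is_solutionE; split=> //=.
      by rewrite andbT; lia.
    by rewrite big_cons big_seq1 fib_family.
  case: m m_le1 => [|[|m]] // _; first exists 1, [tuple 1]; last exists 1, [tuple 3].
    by apply/is_solutionE; rewrite big_seq1.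
  by apply/is_solutionE; rewrite big_seq1.
rewrite is_solutionE; split=> [[[k_gt0 n_sorted prod_n] n_nt] | ].
  have n_nt' : size n = 1 \/ {in tval n, forall i, 2 < i}.
    case: n_nt => [k1|[_ n_gt2]]; [by left; rewrite size_tuple | right => i i_n].
    apply: leq_trans n_gt2 _.
    case: (tval n) n_sorted i_n => // j s; rewrite in_cons /= (path_sortedE leq_trans).
    by case/andP=> /allP le_j _ /orP[/eqP->//|/le_j].
  have [m_lt4|m_ge4] := ltnP m 4; [left | right; split=> //].
    by apply: fib_prod_small n_nt' prod_n; rewrite // size_tuple.
  (* A single index also exceeds 2, because [fib m ^ 2 + 1] is larger than [fib 2]. *)
  apply: fib_prod_family => //; case: n_nt' => // n_size1 i.
  case: (tval n) n_size1 prod_n => [|j [|//]] //= _; rewrite big_seq1 inE => eq_j /eqP->.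
  rewrite ltnNge; apply/negP => /leq_fib; rewrite eq_j.
  have := leq_fib m_ge4; rewrite /=; nia.
have k_size := size_tuple n.
move=> [|[m_ge4 def_n]].
  rewrite !inE => /or4P[||| /orP[]] /eqP[-> def_n];
  move: k_size; rewrite /nontrivial def_n /= => <-;
  by split; [split=> //; rewrite big_seq1 | left].
move: k_size; rewrite /nontrivial def_n /= => <-.
split; last by right; split=> //; rewrite /delta; case: ifP; lia.
split=> //=; first by rewrite andbT; lia.
by rewrite big_cons big_seq1 fib_family //; lia.
Qed.
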